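(* Let $G$ be a compact group with probabilistic Haar measure $\mu$, and let $G_0\triangleleft G$ be an open normal subgroup with probabilistic Haar measure $\mu_0$. Let $X(j)\colon X(G_0)\to X(G)$ be the map on sets of conjugacy classes induced by the inclusion $j\colon G_0\to G$. Let $(x_i)$ be a sequence of elements of $X(G)$ that is equidistributed with respect to $\mu$. Put $k_n:=\#\{x_i\in\mathrm{image}(X(j))\colon 1\le i\le n\}$ and assume that $$\lim_{n\to\infty}\frac{k_n}{n}=\frac{1}{[G:G_0]}.$$ Then the subsequence $(x_{n_k})$ of elements of $(x_i)$ that are contained in the image of $X(j)$ is equidistributed with respect to the pushforward of $\mu_0$.
   Context: $X(G)$ denotes the set of conjugacy classes of $G$ (with the quotient topology), and the pushforward of $\mu$ to $X(G)$ is also denoted $\mu$. Class functions on $G$ are identified with functions on $X(G)$. A sequence $(y_i)$ in $X(G)$ is equidistributed with respect to a probability measure $\nu$ (on $G$ or $X(G)$) if $\lim_{n\to\infty}\frac1n\sum_{i=1}^nf(y_i)=\int f\,d\nu$ for each continuous class function $f$ on $G$. The pushforward of $\mu_0$ is $j_*\mu_0$ (equivalently its image on $X(G)$ under $X(j)$). The count $k_n$ is the number of indices $i\le n$ with $x_i$ in the image of $X(j)$. *)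

(* Defs.v *)
From HB Require Import structures.
From mathcomp Require Import all_boot all_order all_algebra generic_quotient.
From mathcomp Require Import finmap.
From mathcomp Require Import all_classical all_reals all_analysis.
Import numFieldNormedType.Exports.

Set Implicit Arguments.
Unset Strict Implicit.
Unset Printing Implicit Defensive.

Import Order.TTheory GRing.Theory Num.Theory.
Local Open Scope classical_set_scope.
Local Open Scope ring_scope.
Local Open Scope quotient_scope.

(* Multiplicative counterpart of the library's TopologicalZmodule.  The point
   of the underlying ptopologicalType is arbitrary; it is only there because
   the library's measurable types are pointed. *)
HB.mixin Record isTopologicalGroup G of PointedTopological G & Group G := {
  mulg_continuous : continuous (fun x : G * G => (x.1 * x.2)%g) ;
  invg_continuous : continuous (fun x : G => (x^-1)%g)
}.

#[short(type="topologicalGroupType")]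
HB.structure Definition TopologicalGroup :=
  {G of PointedTopological G & Group G & isTopologicalGroup G}.

Definition compact_group (G : topologicalGroupType) : Prop :=
  compact [set: G] /\ hausdorff_space G.

Section Subgroup.
Context {G : topologicalGroupType}.

Definition subgroup (H : groupClosed G) : Type := {x : G | x \in H}.

Section Structure.
Variable H : groupClosed G.

HB.instance Definition _ := SubType.copy (subgroup H) {x : G | x \in H}.
HB.instance Definition _ := [Choice of subgroup H by <:].

Lemma subgroup_closed : group_closed (fun x : G => x \in H).
Proof.
split=> [|x y]; first exact: (gpred1 (s := H)).
exact: (@gpredF _ H x y).
Qed.

HB.instance Definition _ :=
  SubChoice_isSubGroup.Build G _ (subgroup H) subgroup_closed.
HB.instance Definition _ := isPointed.Build (subgroup H) 1%g.
HB.instance Definition _ := Topological.copy (subgroup H)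
  (initial_topology (val : subgroup H -> G)).

Lemma val_subgroup_continuous : continuous (val : subgroup H -> G).
Proof. exact: initial_continuous. Qed.

Let continuous_into_subgroup (T : topologicalType) (f : T -> subgroup H) :
  continuous (val \o f) -> continuous f.
Proof.
move=> /continuousP cf; apply/continuousP => A [B oB <-].
by rewrite -comp_preimage; exact: cf.
Qed.

Let subgroup_mulg_continuous :
  continuous (fun x : subgroup H * subgroup H => (x.1 * x.2)%g).
Proof.
apply: continuous_into_subgroup => -[x y].
rewrite (_ : val \o _ = (fun z : G * G => (z.1 * z.2)%g) \o
  (fun z : subgroup H * subgroup H => (val z.1, val z.2))); last first.
  by apply/funext => -[a b]; exact: gmulfM.
apply: continuous_comp; last exact: mulg_continuous.
apply: cvg_pair => /=.
- by apply: cvg_comp; [exact: cvg_fst|exact: val_subgroup_continuous].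
- by apply: cvg_comp; [exact: cvg_snd|exact: val_subgroup_continuous].
Qed.

Let subgroup_invg_continuous : continuous (fun x : subgroup H => (x^-1)%g).
Proof.
apply: continuous_into_subgroup => x.
rewrite (_ : val \o _ = (fun z : G => (z^-1)%g) \o val); last first.
  by apply/funext => a; exact: gmulfV.
apply: continuous_comp; first exact: val_subgroup_continuous.
exact: invg_continuous.
Qed.

HB.instance Definition _ := isTopologicalGroup.Build (subgroup H)
  subgroup_mulg_continuous subgroup_invg_continuous.

End Structure.

Definition open_subgroup (H : groupClosed G) : Prop := open [set x : G | x \in H].

Definition normal_subgroup (H : groupClosed G) : Prop :=
  forall h g : G, h \in H -> (h ^ g)%g \in H.

Definition left_coset (H : groupClosed G) (g : G) : set G :=
  [set (g * h)%g | h in [set x : G | x \in H]].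

(* fset_set sends an infinite set to fset0, so an infinite index would be 0;
   open subgroups of compact groups have finite index. *)
Definition subgroup_index (H : groupClosed G) : nat :=
  #|` fset_set (range (left_coset H))|.

End Subgroup.

Section ConjugacyClasses.

Definition conjugate (G : groupType) : rel G :=
  fun x y => `[< exists g : G, y = (x ^ g)%g >].

Section Relation.
Variable G : groupType.

Let conjugate_refl : reflexive (@conjugate G).
Proof. by move=> x; apply/asboolP; exists 1%g; rewrite conjg1. Qed.

Let conjugate_sym : symmetric (@conjugate G).
Proof.
suff H (x y : G) : conjugate x y -> conjugate y x by move=> x y; apply/idP/idP; exact: H.
by move=> /asboolP[g ->]; apply/asboolP; exists (g^-1)%g; rewrite -conjgM mulgV conjg1.
Qed.

Let conjugate_trans : transitive (@conjugate G).
Proof.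
move=> y x z /asboolP[g ->] /asboolP[h ->]; apply/asboolP.
by exists (g * h)%g; rewrite conjgM.
Qed.

Canonical conjugate_equiv :=
  EquivRel (@conjugate G) conjugate_refl conjugate_sym conjugate_trans.

End Relation.

Definition conj_classes (G : topologicalGroupType) :=
  quotient_topology {eq_quot @conjugate G}.

Definition conj_class (G : topologicalGroupType) (g : G) : conj_classes G :=
  \pi_(conj_classes G) g.

Lemma conj_classP (G : topologicalGroupType) (x y : G) :
  conj_class x = conj_class y <-> exists g : G, y = (x ^ g)%g.
Proof.
by split=> [/eqquotP/asboolP //|?]; apply/eqquotP/asboolP.
Qed.

Lemma conj_class_repr (G : topologicalGroupType) (c : conj_classes G) :
  conj_class (repr c) = c.
Proof. exact: reprK. Qed.

Definition conj_classes_map (G H : topologicalGroupType)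
    (phi : {multiplicative G -> H}) (c : conj_classes G) : conj_classes H :=
  conj_class (phi (repr c)).

Lemma conj_classes_mapE (G H : topologicalGroupType)
    (phi : {multiplicative G -> H}) (g : G) :
  conj_classes_map phi (conj_class g) = conj_class (phi g).
Proof.
have /conj_classP[h gE] := conj_class_repr (conj_class g).
apply/conj_classP; exists (phi h); rewrite [in LHS]gE.
by apply: (@mulgI _ (phi h)); rewrite -gmulfM -!conjgC gmulfM.
Qed.

Definition class_function (G : groupType) (T : Type) (f : G -> T) : Prop :=
  forall x g : G, f (x ^ g)%g = f x.

(* The identification of class functions on G with functions on X(G). *)
Definition on_classes (G : topologicalGroupType) (T : Type) (f : G -> T)
  (c : conj_classes G) : T := f (repr c).

Lemma on_classesE (G : topologicalGroupType) (T : Type) (f : G -> T) (g : G) :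
  class_function f -> on_classes f (conj_class g) = f g.
Proof.
by move=> cf; have /conj_classP[h {2}->] := conj_class_repr (conj_class g); rewrite cf.
Qed.

End ConjugacyClasses.

Notation borel T := (g_sigma_algebraType (@open T)).

Section Inclusion.
Context {G : topologicalGroupType} (H : groupClosed G).

Definition subgroup_incl : subgroup H -> G := val.

Let subgroup_inclM (x y : subgroup H) :
  subgroup_incl (x * y)%g = (subgroup_incl x * subgroup_incl y)%g.
Proof. exact: gmulfM. Qed.

HB.instance Definition _ :=
  isMultiplicative.Build _ _ subgroup_incl subgroup_inclM.

Definition borel_incl : borel (subgroup H) -> borel G := subgroup_incl.

Let borel_incl_measurable : measurable_fun [set: borel (subgroup H)] borel_incl.
Proof.
apply: (measurability (@open G : set (set (borel G)))) => // _ [U oU <-].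
rewrite setTI; apply: sub_sigma_algebra.
by have /continuousP := @val_subgroup_continuous G H; exact.
Qed.

HB.instance Definition _ :=
  isMeasurableFun.Build _ _ _ _ borel_incl borel_incl_measurable.

End Inclusion.

Section HaarMeasure.
Context {R : realType} {G : topologicalGroupType}.
Local Open Scope ereal_scope.

Definition left_invariant (mu : probability (borel G) R) : Prop :=
  forall (g : G) (A : set (borel G)), measurable A ->
    mu [set (g * x)%g | x in A] = mu A.

Definition regular_measure (mu : probability (borel G) R) : Prop :=
  (forall A : set (borel G), measurable A ->
     mu A = ereal_inf [set mu U | U in [set U : set G | open U /\ A `<=` U]]) /\
  (forall U : set G, open U ->
     mu U = ereal_sup [set mu K | K in [set K : set G | compact K /\ K `<=` U]]).

Definition haar_probability (mu : probability (borel G) R) : Prop :=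
  left_invariant mu /\ regular_measure mu.

End HaarMeasure.

Definition equidistributed (R : realType) (G : topologicalGroupType)
    (nu : probability (borel G) R) (y : nat -> conj_classes G) : Prop :=
  forall f : G -> R, continuous f -> class_function f ->
    (fun n : nat => n%:R^-1 * \sum_(i < n) on_classes f (y i))
      @ \oo --> \int[nu]_x f x.

(* k_n : terms are indexed from 0, so the first n terms are x 0, ..., x n.-1. *)
Definition count_in (T : Type) (A : set T) (x : nat -> T) (n : nat) : nat :=
  #|[set i : 'I_n | x i \in A]|.

(* s is the (unique) increasing enumeration of the indices i with x i in A. *)
Definition enumerates_in (T : Type) (A : set T) (x : nat -> T) (s : nat -> nat)
    : Prop :=
  {homo s : i j / (i < j)%N} /\ range s = [set i | A (x i)].

(* Main.v *)
(* Let [F] be [f] on [G0] and [0] elsewhere: it is again a continuous class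
   function, and its sum over [x_1, ..., x_n] is the sum of [f] over the [x_i]
   in the image of [X(j)]. Equidistribution gives that [n^-1] times this sum
   tends to [\int[mu] F], which equals [mu G0 * \int[mu0] f] by a Fubini
   argument (so uniqueness of Haar measure is not needed). For [f = 1] the
   limit is [mu G0], so the density hypothesis says [mu G0 = [G : G0]^-1]; it
   is nonzero because finitely many cosets cover [G]. Dividing the limits
   along the subsequence [s] gives the result. *)
Require Import Defs.
From HB Require Import structures.
From mathcomp Require Import all_boot all_order all_algebra finmap.
From mathcomp Require Import all_classical all_reals all_analysis.
From mathcomp Require Import measurable_realfun.
Import numFieldNormedType.Exports.
Import Order.TTheory GRing.Theory Num.Theory.
Local Open Scope classical_set_scope.
Local Open Scope ring_scope.

Set Implicit Arguments.
Unset Strict Implicit.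
Unset Printing Implicit Defensive.

(** * Increasing enumerations of sets of indices *)

Lemma increasing_geq_id (s : nat -> nat) n :
  {homo s : i j / (i < j)%N} -> (n <= s n)%N.
Proof.
by move=> s_incr; elim: n => // n IHn; exact: leq_ltn_trans IHn (s_incr _ _ _).
Qed.

Lemma increasing_enumeration (A : set nat) :
  (forall n, exists2 m, (n <= m)%N & A m) ->
  exists s : nat -> nat, {homo s : i j / (i < j)%N} /\ range s = A.
Proof.
move=> Aub.
have ex n : exists m, (n <= m)%N && `[< A m >].
  by have [m nm Am] := Aub n; exists m; rewrite nm; exact/asboolP.
pose next n := ex_minn (ex n).
have next_ge n : (n <= next n)%N by rewrite /next; case: ex_minnP => m /andP[].
have next_in n : A (next n).
  by rewrite /next; case: ex_minnP => m /andP[_ /asboolP].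
have next_le n m : (n <= m)%N -> A m -> (next n <= m)%N.
  rewrite /next => nm Am; case: ex_minnP => k _; apply.
  by rewrite nm; exact/asboolP.
(* Each term is the least element of [A] beyond the previous one, so no element is skipped. *)
pose s := fix s n := if n is k.+1 then next (s k).+1 else next 0%N.
have s_incr : {homo s : i j / (i < j)%N}.
  by apply: homo_ltn => [? ? ?|n]; [exact: ltn_trans|exact: next_ge].
exists s; split=> //; apply/seteqP; split=> [_ [[|n] _ <-]|a Aa];
  [exact: next_in..|].
(* Some term does exceed [a]: a strictly increasing [s] satisfies [a < s a.+1]. *)
suff H n : (a < s n)%N -> exists i, s i = a.
  by have [i <-] := H a.+1 (increasing_geq_id a.+1 s_incr); exists i.
elim: n => [|n IHn]; first by rewrite ltnNge next_le.
have [/IHn //|] := ltnP a (s n).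
rewrite leq_eqVlt => /predU1P[<-|lt_sn]; first by exists n.
by rewrite ltnNge next_le.
Qed.

Lemma count_inE (T : Type) (A : set T) (x : nat -> T) n :
  count_in A x n = (\sum_(i < n | x i \in A) 1)%N.
Proof.
by rewrite /count_in -sum1_card; apply: eq_bigl => i; rewrite unfold_in asboolb.
Qed.

Section Enumeration.
Variables (T : Type) (A : set T) (x : nat -> T) (s : nat -> nat).
Hypothesis s_enum : enumerates_in A x s.

(** Both lists are strictly increasing, so it suffices that they have the same members. *)
Lemma filter_iota_enumerates_in n :
  [seq i <- iota 0 (s n) | x i \in A] = [seq s j | j <- iota 0 n].
Proof.
have [s_incr s_range] := s_enum.
apply: (irr_sorted_eq ltn_trans ltnn).
- exact: sorted_filter ltn_trans _ _ (iota_ltn_sorted 0 _).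
- rewrite sorted_map; apply: sub_sorted (iota_ltn_sorted 0 _).
  exact: s_incr.
move=> i; rewrite mem_filter mem_iota add0n leq0n /=.
apply/andP/mapP => [[/set_mem Axi lt_i]|[j]].
  have : range s i by rewrite s_range.
  case=> j _ ji; exists j => //; rewrite mem_iota add0n ltnNge.
  apply: contraL lt_i; rewrite -ji -leqNgt.
  exact: (homo_leq (fun=> leqnn _) leq_trans (fun k => ltnW (s_incr _ _ (ltnSn k)))).
rewrite mem_iota add0n => jn ->; rewrite s_incr //; split=> //; apply/mem_set.
by have : range s (s j) by []; rewrite s_range.
Qed.

Lemma big_enumerates_in (R : Type) (idx : R) (op : R -> R -> R) (g : nat -> R) n :
  \big[op/idx]_(i < s n | x i \in A) g i = \big[op/idx]_(j < n) g (s j).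
Proof.
rewrite -(big_mkord (fun i => x i \in A)) -(big_mkord xpredT (g \o s)).
by rewrite -big_filter /index_iota !subn0 filter_iota_enumerates_in big_map.
Qed.

(** Only indices strictly below [s n] are counted; those in question are [s 0, ..., s n.-1]. *)
Lemma count_in_enumerates_in n : count_in A x (s n) = n.
Proof.
by rewrite count_inE (big_enumerates_in _ _ (fun=> 1%N)) sum1_card card_ord.
Qed.

End Enumeration.

(** If no term from [n0] on lay in [A], the count would stay at most [n0], and the quotient would be
    squeezed to 0. *)
Lemma count_in_unbounded (R : realType) (T : Type) (A : set T) (x : nat -> T)
    (c : R) :
  c != 0 -> (fun n : nat => (count_in A x n)%:R / n%:R : R) @ \oo --> c ->
  forall n, exists2 m, (n <= m)%N & A (x m).
Proof.
move=> c0 cvg_c n0; apply: contrapT => noA; move/eqP: c0; apply.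
apply: (cvg_unique _ cvg_c) => //.
apply: (@squeeze_cvgr _ _ _ _ (fun=> 0) (fun n : nat => n0%:R * n%:R^-1)).
- near=> n; rewrite divr_ge0 //= ler_wpM2r ?invr_ge0 // ler_nat.
  rewrite count_inE -[leqRHS]card_ord -sum1_card.
  rewrite (big_ord_widen n (fun=> 1%N)); last by near: n; exists n0.
  rewrite big_mkcond [leqRHS]big_mkcond; apply: leq_sum => i _.
  have [xi|] := boolP (x i \in A) => //; case: (ltnP i n0) => // ni.
  by case: noA; exists i => //; exact: set_mem.
- exact: cvg_cst.
- rewrite -[0](mulr0 n0%:R); apply: cvgM; first exact: cvg_cst.
  apply/gtr0_cvgV0; last exact: cvgr_idn.
  by exists 1%N => // n; rewrite /= ltr0n.
Unshelve. all: by end_near.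
Qed.

(** * Open and normal subgroups, class functions *)

Section OpenSubgroup.
Context {G : topologicalGroupType}.

Lemma mulg_continuousl (g : G) : continuous (fun y : G => (g * y)%g).
Proof.
move=> y; apply: (@continuous_comp _ _ _ (fun y => (g, y)) (fun z => (z.1 * z.2)%g)).
  by apply: cvg_pair; [exact: cvg_cst|exact: cvg_id].
exact: mulg_continuous.
Qed.

Lemma left_coset_open (H : groupClosed G) (g : G) :
  open_subgroup H -> open (left_coset H g).
Proof.
move=> oH; rewrite [left_coset H g](_ : _ =
    (fun y => (g^-1 * y)%g) @^-1` [set x | x \in H]).
  by move/continuousP : (@mulg_continuousl g^-1%g); exact.
apply/seteqP; split=> [_ [h hH <-]|y yH] /=; first by rewrite mulKg.
by exists (g^-1 * y)%g => //; rewrite mulVKg.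
Qed.

Lemma left_coset_refl (H : groupClosed G) (g : G) : left_coset H g g.
Proof. by exists 1%g; [exact: gpred1|rewrite mulg1]. Qed.

(** Membership in [H] is constant on the coset [g H], an open neighbourhood of [g]. This is what
    lets functions be glued along [H]. *)
Lemma open_subgroup_near (H : groupClosed G) (g : G) :
  open_subgroup H -> \forall y \near g, (y \in H) = (g \in H).
Proof.
move=> oH; near=> y.
suff [h hH <-] : left_coset H g y by rewrite gpredMr.
near: y; apply: open_nbhs_nbhs; split; first exact: left_coset_open.
exact: left_coset_refl.
Unshelve. all: by end_near.
Qed.

Lemma open_subgroup_if_continuous (T : topologicalType) (H : groupClosed G)
    (f g : G -> T) :
  open_subgroup H -> continuous f -> continuous g ->
  continuous (fun x => if x \in H then f x else g x).
Proof.
move=> oH cf cg x; rewrite /continuous_at.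
have [xH|xH] := boolP (x \in H).
  apply: cvg_trans (cf x); apply: near_eq_cvg; near=> y.
  by rewrite (near (open_subgroup_near x oH) y) // xH.
apply: cvg_trans (cg x); apply: near_eq_cvg; near=> y.
by rewrite (near (open_subgroup_near x oH) y) // (negbTE xH).
Unshelve. all: by end_near.
Qed.

(* [H] is the image of [G] under the continuous retraction sending the
   complement of [H] to [1]. *)
Lemma open_subgroup_compact (H : groupClosed G) :
  compact [set: G] -> open_subgroup H -> compact [set: subgroup H].
Proof.
move=> cG oH; pose p (x : G) : subgroup H := insubd 1%g x.
have cp : continuous p.
  apply/continuousP => A [B oB <-]; rewrite -comp_preimage.
  have /continuousP : continuous (val \o p); last exact.
  rewrite (_ : val \o p = fun x => if x \in H then x else 1%g).
    apply: open_subgroup_if_continuous oH _ _ => x; [exact: cvg_id|exact: cvg_cst].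
  by apply/funext => x; rewrite /= val_insubd.
rewrite [setT](_ : _ = p @` setT).
  by apply: continuous_compact cG; exact: continuous_subspaceT.
by apply/seteqP; split=> // y _; exists (val y) => //; exact: valKd.
Qed.

Definition extend_by_zero (R : realType) (H : groupClosed G) (f : G -> R)
    (x : G) : R :=
  if x \in H then f x else 0.

Lemma extend_by_zero_continuous (R : realType) (H : groupClosed G) (f : G -> R) :
  open_subgroup H -> continuous f -> continuous (extend_by_zero H f).
Proof.
by move=> oH cf; apply: open_subgroup_if_continuous => // x; exact: cvg_cst.
Qed.

Lemma normal_subgroupJ (H : groupClosed G) (x g : G) :
  normal_subgroup H -> (x ^ g \in H)%g = (x \in H).
Proof.
move=> nH; apply/idP/idP => [/(nH _ g^-1%g)|]; last exact: nH.
by rewrite -conjgM mulgV conjg1.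
Qed.

Lemma extend_by_zero_class_function (R : realType) (H : groupClosed G) (f : G -> R) :
  normal_subgroup H -> class_function f -> class_function (extend_by_zero H f).
Proof.
by move=> nH cf x g; rewrite /extend_by_zero normal_subgroupJ // cf.
Qed.

(** [y * x] is the conjugate of [x * y] by [x]. *)
Lemma class_functionC (T : Type) (f : G -> T) (x y : G) :
  class_function f -> f (x * y)%g = f (y * x)%g.
Proof. by move=> cf; rewrite -(cf (x * y)%g x) conjgE !mulgA mulVg mul1g. Qed.

(** A class in the image contains some element of [H]; by normality every conjugate of it, in
    particular the chosen representative, is in [H]. *)
Lemma range_conj_classes_map_incl (H : groupClosed G) (c : conj_classes G) :
  normal_subgroup H ->
  range (conj_classes_map (@subgroup_incl G H)) c <-> repr c \in H.
Proof.
move=> nH; split=> [[d _ <-]|cH].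
  have [g gE] := (conj_classP _ _).1 (conj_class_repr
    (conj_classes_map (@subgroup_incl G H) d)).
  rewrite -(normal_subgroupJ _ g) // -gE; exact: valP.
exists (conj_class (Sub (repr c) cH : subgroup H)) => //.
rewrite conj_classes_mapE; exact: conj_class_repr.
Qed.

End OpenSubgroup.

(** * Measurability and integration of continuous functions on compact spaces *)

Lemma open_measurable_borel (T : ptopologicalType) (A : set T) :
  open A -> measurable (A : set (borel T)).
Proof. by move=> oA; exact: sub_sigma_algebra. Qed.

Lemma continuous_measurable_borel (R : realType) (T : ptopologicalType) (f : T -> R) :
  continuous f -> measurable_fun [set: borel T] (f : borel T -> R).
Proof.
move=> /continuousP cf; apply: (measurability _ (RGenOInfty.measurableE R)) => //.
move=> /= _ [_ [r ->] <-]; rewrite setTI; apply: open_measurable_borel.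
by apply: cf; rewrite set_itvE; exact: open_gt.
Qed.

Lemma continuous_measurable_borel_map (S T : ptopologicalType) (f : S -> T) :
  continuous f -> measurable_fun [set: borel S] (f : borel S -> borel T).
Proof.
move=> /continuousP cf; apply: (measurability (@open T : set (set (borel T)))) => //.
by move=> _ [U oU <-]; rewrite setTI; apply: open_measurable_borel; exact: cf.
Qed.

Lemma continuous_bounded (R : realType) (T : topologicalType) (f : T -> R) :
  compact [set: T] -> continuous f -> [bounded f x | x in [set: T]].
Proof.
move=> cT cf.
have /compact_bounded : compact (f @` setT).
  by apply: continuous_compact => //; exact: continuous_subspaceT.
move=> [M [Mreal MP]]; exists M; split=> // r /MP fr x _.
by apply: fr; exists x.
Qed.

(* The product of the Borel sigma-algebras may be smaller than the Borel
   sigma-algebra of the product; compactness is what makes [f > r] a countable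
   union of finite unions of open rectangles. *)
Lemma continuous_measurable_prod (R : realType) (S T : ptopologicalType)
    (f : S * T -> R) :
  compact [set: S] -> compact [set: T] -> continuous f ->
  measurable_fun [set: borel S * borel T] (f : borel S * borel T -> R).
Proof.
move=> cS cT cf; apply: (measurability _ (RGenOInfty.measurableE R)) => //.
move=> /= _ [_ [r ->] <-]; rewrite setTI.
(* The sets [K n] are closed, hence compact, and exhaust [[f > r]]; each is covered by finitely many
   of the open rectangles in [P]. *)
pose K n := [set z | r + n.+1%:R^-1 <= f z].
pose P := [set D : set S * set T | [/\ open D.1, open D.2 &
  D.1 `*` D.2 `<=` [set z | r < f z]]].
have fin n : exists A, [/\ measurable (A : set (borel S * borel T)),
      K n `<=` A & A `<=` [set z | r < f z]].
  have cK : compact (K n).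
    apply: (@subclosed_compact _ _ setT) => //.
      apply: (@preimage_closed _ _ f [set y | r + n.+1%:R^-1 <= y]).
        by move=> z _; exact: cf.
      exact: closed_ge.
    by rewrite -setXTT; exact: compact_setX.
  pose ST : ptopologicalType :=
    HB.pack (S * T)%type (Pointed.on (S * T)%type).
  move: cK; rewrite (@compact_cover ST).
  move=> /(_ _ P (fun D => D.1 `*` D.2)) [].
  - move=> D [oD1 oD2 _]; rewrite openE => -[a b] [/= Da Db].
    by exists (D.1, D.2) => //; split; exact: open_nbhs_nbhs.
  - move=> z Kz.
    have : nbhs z [set z | r < f z].
      apply: (cf z [set y | r < y]); apply: open_nbhs_nbhs; split.
        exact: open_gt.
      by rewrite /= (lt_le_trans _ Kz) // ltrDl invr_gt0.
    move=> [[A B] /= [nA nB] sub].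
    (* A neighbourhood in the product contains some [A * B] with [A], [B] neighbourhoods, not
       necessarily open; their interiors give a member of [P]. *)
    exists (A°, B°).
      split; [exact: open_interior..|].
      move=> [a b] [/= /interior_subset ? /interior_subset ?].
      exact: sub.
    by split; exact: nbhs_singleton (nbhs_interior _).
  move=> D sD subD; exists (cover [set` D] (fun D => D.1 `*` D.2)); split => //.
  - rewrite /cover bigcup_fset big_seq; apply: big_ind.
    + exact: measurable0.
    + by move=> ? ?; exact: measurableU.
    + move=> E /sD /set_mem [oE1 oE2 _].
      by apply: measurableX; exact: open_measurable_borel.
  - by move=> z [E /= /sD /set_mem [_ _ sE]]; exact: sE.
have [A AP] := choice fin.
rewrite [X in measurable X](_ : _ = \bigcup_n A n).
  by apply: bigcup_measurable => n _; have [] := AP n.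
apply/seteqP; split=> [z|z [n _]]; last first.
  by have [_ _ /[apply]] := AP n; rewrite /= in_itv /= andbT.
rewrite /= in_itv /= andbT => rz.
have [n nz] := ltr_add_invr rz.
have [_ KA _] := AP n; exists n => //; apply: KA.
exact: ltW.
Qed.

Section CompactIntegral.
Context {R : realType} {S T : ptopologicalType}.
Hypotheses (cS : compact [set: S]) (cT : compact [set: T]).

Lemma continuous_integrable (mu : probability (borel T) R) (f : T -> R) :
  continuous f -> mu.-integrable [set: borel T] (EFin \o f).
Proof.
move=> cf; apply: measurable_bounded_integrable => //.
- by rewrite (le_lt_trans (probability_le1 _ _)) // ltry.
- exact: continuous_measurable_borel.
- exact: continuous_bounded.
Qed.

Lemma continuous_Fubini (mu : probability (borel S) R)
    (nu : probability (borel T) R) (f : S * T -> R) : continuous f ->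
  (\int[mu]_x \int[nu]_y (f (x, y))%:E = \int[nu]_y \int[mu]_x (f (x, y))%:E)%E.
Proof.
move=> cf; apply: (@Fubini _ _ _ _ _ mu nu (EFin \o f)).
apply: measurable_bounded_integrable => //.
(* The product measure has total mass 1, so bounded measurable functions are integrable. *)
- have := etrans (product_measure1E mu nu measurableT measurableT)
      (congr2 mule (probability_setT mu) (probability_setT nu)).
  rewrite setXTT mule1 => muT.
  suff : ((mu \x nu)%E [set: borel S * borel T] < +oo)%E by [].
  by rewrite muT ltry.
- exact: continuous_measurable_prod.
- by apply: continuous_bounded => //; rewrite -setXTT; exact: compact_setX.
Qed.

End CompactIntegral.

(** * Left-invariant probability measures *)

Section Haar.
Context {R : realType} {G : topologicalGroupType}.

Lemma measurable_mulgl (g : G) :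
  measurable_fun [set: borel G] (fun x : borel G => (g * x)%g : borel G).
Proof. by apply: continuous_measurable_borel_map; exact: mulg_continuousl. Qed.

Lemma left_invariant_integral (mu : probability (borel G) R) (f : G -> R) (g : G) :
  compact [set: G] -> left_invariant mu -> continuous f ->
  (\int[mu]_x (f (g * x)%g)%:E = \int[mu]_x (f x)%:E)%E.
Proof.
move=> cG mu_inv cf.
have cfg : continuous (fun x => f (g * x)%g).
  move=> x; apply: (@continuous_comp _ _ _ (fun x => g * x)%g f).
    exact: mulg_continuousl.
  exact: cf.
transitivity
  (\int[pushforward mu (fun x : borel G => (g * x)%g : borel G)]_x (f x)%:E)%E.
  rewrite integral_pushforward //.
  - exact: measurable_mulgl.
  - exact: measurable_int (continuous_integrable cG mu cf).
  - exact: continuous_integrable.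
apply: eq_measure_integral => [|? A mA _]; first exact: measurable_mulgl.
(* The preimage of [A] under translation by [g] is the translate of [A] by [g^-1]. *)
rewrite -[RHS](mu_inv g^-1%g) // /= /pushforward; congr (mu _).
apply/seteqP; split=> [x Ax|_ [x Ax <-]] /=; last by rewrite mulVKg.
by exists (g * x)%g => //; rewrite mulKg.
Qed.

(** By compactness finitely many left cosets cover [G]. They all have the measure of [H], so if it
    vanished, [mu] of the whole group would be 0 instead of 1. *)
Lemma left_invariant_open_subgroup_neq0 (mu : probability (borel G) R)
    (H : groupClosed G) :
  compact [set: G] -> left_invariant mu -> open_subgroup H ->
  mu [set x | x \in H] != 0%E.
Proof.
move=> cG mu_inv oH; apply/eqP => muH0.
have mH : measurable ([set x | x \in H] : set (borel G)).
  exact: open_measurable_borel.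
have : mu.-negligible [set: borel G].
  move: cG; rewrite compact_cover => /(_ _ setT (left_coset H))[].
  - by move=> g _; exact: left_coset_open.
  - by move=> g _; exists g => //; exact: left_coset_refl.
  move=> D _ GD.
  suff : mu.-negligible (cover [set` D] (left_coset H) : set (borel G)).
    by apply: negligibleS; exact: GD.
  rewrite /cover bigcup_fset.
  apply: big_ind => [|A B|g _].
  - exact: negligible_set0.
  - exact: negligibleU.
  - apply/negligibleP; last exact: etrans (mu_inv g _ mH) muH0.
    by apply: open_measurable_borel; exact: left_coset_open.
move=> /(measure_negligible measurableT) muT0.
by have /eqP := etrans (esym (probability_setT mu)) muT0; rewrite onee_eq0.
Qed.

End Haar.

(* Integrate [f 1_H (x y)] over [mu] in [x] and over [nu] in [y].  As [f 1_H]
   is a class function, left invariance gives its [mu]-integral for each [y];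
   for each [x] it gives [\int[nu] f] if [x \in H] and [0] otherwise. *)
Lemma integral_extend_by_zero (R : realType) (G : topologicalGroupType)
    (H : groupClosed G) (mu : probability (borel G) R)
    (nu : probability (borel (subgroup H)) R) (f : G -> R) :
  compact [set: G] -> left_invariant mu -> left_invariant nu ->
  open_subgroup H -> normal_subgroup H -> continuous f -> class_function f ->
  \int[mu]_x extend_by_zero H f x =
  fine (mu [set x | x \in H]) * \int[distribution nu (@borel_incl G H)]_x f x.
Proof.
move=> cG mu_inv nu_inv oH nH cf clf.
have cH : compact [set: subgroup H] by exact: open_subgroup_compact.
have cF : continuous (extend_by_zero H f) by exact: extend_by_zero_continuous.
have clF : class_function (extend_by_zero H f).
  exact: extend_by_zero_class_function.
have cfH : continuous (f \o val : subgroup H -> R).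
  by move=> y; apply: continuous_comp; [exact: val_subgroup_continuous|exact: cf].
set F := extend_by_zero H f in cF clF *.
have cFM : continuous (fun z : G * subgroup H => F (z.1 * val z.2)%g).
  move=> z; apply: (@continuous_comp _ _ _
    (fun z : G * subgroup H => (z.1 * val z.2)%g)); last exact: cF.
  apply: (@continuous_comp _ _ _ (fun z : G * subgroup H => (z.1, val z.2))
    (fun z => (z.1 * z.2)%g)).
    apply: cvg_pair => /=; first exact: cvg_fst.
    by apply: cvg_comp; [exact: cvg_snd|exact: val_subgroup_continuous].
  exact: mulg_continuous.
have mH : measurable ([set x | x \in H] : set (borel G)).
  exact: open_measurable_borel.
pose P := (\int[mu]_x (F x)%:E)%E; pose L := (\int[nu]_y (f (val y))%:E)%E.
(* The right translation by [y] becomes a left one, because [F] is a class function. *)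
have intP (y : subgroup H) : (\int[mu]_x (F (x * val y)%g)%:E = P)%E.
  under eq_integral do rewrite class_functionC //.
  exact: left_invariant_integral.
have intL x : (\int[nu]_y (F (x * val y)%g)%:E =
    L * (\1_[set x | x \in H] x)%:E)%E.
  rewrite indicE; have [xH|xH] := boolP (x \in H).
    rewrite mem_set // mule1 /L.
    rewrite -(left_invariant_integral (Sub x xH : subgroup H) cH nu_inv cfH).
    apply: eq_integral => y _ /=; rewrite /F /extend_by_zero.
    by rewrite gpredMl // (valP y).
  rewrite memNset ?mule0 //=; last exact/negP.
  apply: integral0_eq => y _; rewrite /F /extend_by_zero.
  by rewrite gpredMr ?(valP y) // (negbTE xH).
have LE : L = (\int[distribution nu (@borel_incl G H)]_x f x)%:E.
  rewrite /Rintegral integral_distribution.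
  - rewrite fineK //.
    exact: integrable_fin_num (continuous_integrable cH nu cfH).
  - exact: measurable_int (continuous_integrable cG mu cf).
  - by have := continuous_integrable cH nu cfH.
(* The two iterated integrals evaluate to [L * mu H] and to [P] times the total mass 1 of [nu]. *)
have := continuous_Fubini cG cH mu nu cFM => /=.
under eq_integral do rewrite intL LE.
under [RHS]eq_integral do rewrite intP.
rewrite integralZl //; last exact: integrable_indic.
rewrite integral_indic // setIT integral_cst //.
rewrite [X in _ = (P * X)%E](probability_setT nu) mule1.
move=> /(congr1 fine); rewrite /Rintegral => <-.
by rewrite fineM ?fin_num_measure // mulrC.
Qed.

(** * Equidistribution of the subsequence *)

Lemma sum_extend_by_zero (R : realType) (G : topologicalGroupType)
    (H : groupClosed G) (f : G -> R) (x : nat -> conj_classes G) n :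
  normal_subgroup H ->
  \sum_(i < n) on_classes (extend_by_zero H f) (x i) =
  \sum_(i < n | x i \in range (conj_classes_map (@subgroup_incl G H)))
    on_classes f (x i).
Proof.
move=> nH; rewrite [RHS]big_mkcond; apply: eq_bigr => i _.
rewrite /on_classes /extend_by_zero; congr (if _ then _ else _).
have [xH imx] := range_conj_classes_map_incl (x i) nH.
by apply/idP/idP => [/imx/mem_set //|/set_mem/xH].
Qed.

Theorem proposition10p7 (R : realType) (G : topologicalGroupType)
    (G_compact : compact_group G)
    (mu : probability (borel G) R) (mu_haar : haar_probability mu)
    (G0 : groupClosed G) (G0_open : open_subgroup G0)
    (G0_normal : normal_subgroup G0)
    (mu0 : probability (borel (subgroup G0)) R)
    (mu0_haar : haar_probability mu0)
    (x : nat -> conj_classes G) (x_equi : equidistributed mu x) :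
  let im := range (conj_classes_map (@subgroup_incl G G0)) in
  (fun n : nat => (count_in im x n)%:R / n%:R : R)
    @ \oo --> ((subgroup_index G0)%:R^-1 : R) ->
  (exists s : nat -> nat, enumerates_in im x s) /\
  (forall s : nat -> nat, enumerates_in im x s ->
     equidistributed (distribution mu0 (@borel_incl G G0)) (x \o s)).
Proof.
set c := (subgroup_index G0)%:R^-1 => im cvg_c.
have [[cG _] [mu_inv _] [mu0_inv _]] := And3 G_compact mu_haar mu0_haar.
have int_ext (f : G -> R) : continuous f -> class_function f ->
    (fun n : nat => n%:R^-1 * \sum_(i < n | x i \in im) on_classes f (x i)) @ \oo -->
    fine (mu [set y | y \in G0]) *
      \int[distribution mu0 (@borel_incl G G0)]_y f y.
  move=> cf clf; rewrite -integral_extend_by_zero //.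
  under eq_fun do rewrite -sum_extend_by_zero //.
  apply: x_equi; first exact: extend_by_zero_continuous.
  exact: extend_by_zero_class_function.
(* The density hypothesis itself identifies [c] as the Haar measure of [G0]. *)
have cE : fine (mu [set y | y \in G0]) = c.
  have := int_ext (cst 1) (@cst_continuous _ _ _) (fun _ _ => erefl).
  rewrite Rintegral_cst // [fine (_ setT)](congr1 fine (probability_setT mu0)).
  rewrite !mulr1.
  move=> /cvg_unique; apply=> //; apply: cvg_trans cvg_c.
  apply: near_eq_cvg; near=> n.
  by rewrite mulrC count_inE natr_sum.
(* Since an infinite index is encoded as 0 and [0^-1 = 0], this is not automatic; it comes from the
   positive measure of [G0]. *)
have c0 : c != 0.
  have mG0 : measurable ([set y | y \in G0] : set (borel G)).
    exact: open_measurable_borel.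
  rewrite -cE fine_eq0 ?fin_num_measure //.
  exact: left_invariant_open_subgroup_neq0.
split; first exact: increasing_enumeration (count_in_unbounded c0 cvg_c).
move=> s s_enum f cf clf; have [s_incr _] := s_enum.
have cvg_s : s @ \oo --> \oo.
  move=> A [N _ NA]; exists N => // n /= Nn; apply: NA.
  exact: leq_trans Nn (increasing_geq_id n s_incr).
have cvg_f := cvg_comp _ _ cvg_s (int_ext f cf clf).
have cvg_k := cvg_comp _ _ cvg_s cvg_c.
rewrite [X in _ --> X](_ : _ =
    c^-1 * (c * \int[distribution mu0 (@borel_incl G G0)]_y f y)); last first.
  by rewrite mulKf.
rewrite cE in cvg_f.
(* The count at [s n] is [n], so the average over [n] terms of the subsequence is [s n / n] times
   the normalized sum up to [s n]. *)
apply: cvg_trans (cvgM (cvgV c0 cvg_k) cvg_f); apply: near_eq_cvg; near=> n.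
rewrite /= count_in_enumerates_in //.
rewrite (big_enumerates_in s_enum _ _ (fun i => on_classes f (x i))).
(* Cancelling [s n] needs [n >= 1], since [s 0] may be 0. *)
have s_gt0 : (s n)%:R != 0 :> R.
  rewrite pnatr_eq0 -lt0n (leq_trans _ (increasing_geq_id n s_incr)) //.
  by near: n; exists 1%N.
by rewrite invf_div mulrA [_ / _ / _]mulrAC divff // mul1r.
Unshelve. all: by end_near.
Qed.
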